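(* For $c>0$ let $\nu^c=\bigotimes_{n\in\mathbb{Z}}\nu^c_n$ be the product measure on $\{0,1\}^{\mathbb{Z}}$ with marginals $$\nu^c_n(0)=1-\nu^c_n(1)=\frac12+\frac{c}{\sqrt n}\cdot\mathbf{1}_{[n\ge1,\ c/\sqrt n<1/2]}.$$ Let $D>1/6$ be the constant such that the Bernoulli shift $(\{0,1\}^{\mathbb{Z}},\mathcal{B},\nu^c,T)$ is conservative for all $c\in(0,D)$ and dissipative for all $c>D$, and, for every $k\in\mathbb{Z}^+$ and $c\in(D/\sqrt{k+1},D/\sqrt k)$, is of ergodic index $k$. Let $1\le k'<k$ be integers. If $c\in(D/\sqrt{k+1},\,D/\sqrt{k})$ and $c'\in(D/\sqrt{k'+1},\,D/\sqrt{k'})$, then the Bernoulli shift given by $\nu^{c'}$ is not a factor of the Bernoulli shift given by $\nu^c$.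
   Context: $T$ is the left-shift $(Tx)_i=x_{i+1}$ on $\{0,1\}^{\mathbb{Z}}$ and $\mathcal{B}$ is the Borel product sigma-algebra. The formula for $\nu^c_n$ means $\nu_n^c(0)=1/2$ when $n\le0$ or $c/\sqrt n\ge1/2$. A constant $D$ with the stated properties exists (and is unique, being the threshold between conservative and dissipative behaviour). A nonsingular system $(\Omega,\mathcal{F},\mu,S)$ is conservative if for every $E$ with $\mu(E)>0$ there is a nonzero integer $n$ with $\mu(E\cap S^{-n}E)>0$; it is (totally) dissipative if, up to a null set, $\Omega$ is the disjoint union of the sets $S^nW$, $n\in\mathbb{Z}$, for some measurable $W$. The ergodic index of an ergodic system is the positive integer $k$ such that its $k$-fold direct product with itself is ergodic but the $(k+1)$-fold direct product is not. The measure $\nu$ is a factor of $\rho$ (nonsingular product measures on $\{0,1\}^{\mathbb{Z}}$) if there is a measurable map $\phi:\{0,1\}^{\mathbb{Z}}\to\{0,1\}^{\mathbb{Z}}$ with $\phi\circ T=T\circ\phi$ such that $\rho\circ\phi^{-1}$ is equivalent to $\nu$ (mutually absolutely continuous). *)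

(* Defs.v *)
From HB Require Import structures.
From mathcomp Require Import all_boot all_order all_algebra.
From mathcomp Require Import all_classical all_reals all_analysis.
From mathcomp Require Import measurable_realfun lra.

Set Implicit Arguments.
Unset Strict Implicit.
Unset Printing Implicit Defensive.

Import Order.TTheory GRing.Theory Num.Theory.
Import numFieldNormedType.Exports.

Local Open Scope classical_set_scope.
Local Open Scope ring_scope.

(* [{0,1}^Z] with [0 = false] and [1 = true]; the product topology [{ptws _ -> _}]
   is taken over the discrete space [bool]. *)
Definition config := g_sigma_algebraType (@open {ptws int -> bool}).

Definition left_shift (x : config) : config := fun i => x (i + 1).

Definition cylinder (s : seq int) (A : int -> set bool) : set config :=
  [set x | forall n, n \in s -> A n (x n)].

Lemma open_config (U : set {ptws int -> bool}) (x : {ptws int -> bool}) :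
  open U -> U x -> exists s : seq int, cylinder s (fun n => [set x n]) `<=` U.
Proof.
move=> oU Ux.
pose F : set_system {ptws int -> bool} :=
  filter_from [set: seq int] (fun s => cylinder s (fun n => [set x n])).
have FF : Filter F.
  apply: filter_from_filter; first by exists [::].
  move=> s t _ _; exists (s ++ t) => // y /= yx.
  by split=> i si; apply: yx; rewrite mem_cat si ?orbT.
suff /(_ U) : F --> x.
  by move=> /(_ (open_nbhs_nbhs (conj oU Ux))) [s _ sU]; exists s.
apply/cvg_sup => i A.
rewrite nbhsE => -[B [[C oC CB] Bx] BA].
exists [:: i] => // y /= yx; apply: BA; rewrite -CB /=.
by rewrite yx ?mem_head//; move: Bx; rewrite -CB.
Qed.

Lemma open_config_cylinders (U : set {ptws int -> bool}) : open U ->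
  U = \bigcup_(w in [set w : seq int * seq int |
                      cylinder w.1 (fun n => [set n \in w.2]) `<=` U])
        cylinder w.1 (fun n => [set n \in w.2]).
Proof.
move=> oU; apply/seteqP; split => [x Ux|x [w wU]]; last exact: wU.
have [s sU] := open_config oU Ux.
have E n : n \in s -> x n = (n \in [seq i <- s | x i]).
  by move=> ns; rewrite mem_filter ns andbT.
exists (s, [seq i <- s | x i]) => [y /= sy|n ns /=]; last exact: E.
by apply: sU => n ns /=; rewrite sy// -E.
Qed.

Lemma measurable_coordinate (n : int) :
  measurable_fun [set: config] (fun x : config => x n).
Proof.
move=> _ B _; rewrite setTI; apply: sub_sigma_algebra.
pose K (_ : int) : topologicalType := bool.
have /continuousP/(_ B) : continuous (@proj int K n : prod_topology K -> K n).
  exact: proj_continuous.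
by apply; exact: discrete_open.
Qed.

Lemma cylinderE s A : cylinder s A =
  \bigcap_(n in [set` s]) ((fun x : config => x n) @^-1` A n).
Proof. by apply/seteqP; split => x /= xA n; exact: xA. Qed.

Lemma measurable_cylinder s A : measurable (cylinder s A).
Proof.
rewrite cylinderE; apply: fin_bigcap_measurable; first exact: finite_seq.
by move=> n _; rewrite -[X in measurable X]setTI; exact: measurable_coordinate.
Qed.

Definition cylinders : set (set config) :=
  [set C | exists2 s, uniq s & exists A, C = cylinder s A].

Lemma cylindersP s A : cylinders (cylinder s A).
Proof.
exists (undup s); first exact: undup_uniq.
by exists A; apply/seteqP; split => x /= xA n ns; apply: xA; move: ns;
   rewrite mem_undup.
Qed.

Lemma measurable_cylinders : @measurable _ config = <<s cylinders >>.
Proof.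
apply/seteqP; split; last first.
  apply: smallest_sub; first exact: sigma_algebra_measurable.
  by move=> _ [s _ [A ->]]; exact: measurable_cylinder.
apply: smallest_sub; first exact: smallest_sigma_algebra.
move=> U /open_config_cylinders ->; rewrite bigcup_mkcond.
apply: (@countable_bigcupT_measurable _ (g_sigma_algebraType cylinders)).
  exact: countableP.
move=> w; case: ifPn => _; last exact: measurable0.
by apply: sub_sigma_algebra; exact: cylindersP.
Qed.

Section product_measure.
Context {R : realType}.
Implicit Types m : int -> probability bool R.

Definition is_product_measure m (P : probability config R) :=
  forall (s : seq int) (A : int -> set bool), uniq s ->
    P [set x : config | forall n, n \in s -> A n (x n)] =
    (\prod_(n <- s) m n (A n))%E.

Lemma is_product_measure_unique m P Q :
  is_product_measure m P -> is_product_measure m Q ->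
  forall A, measurable A -> P A = Q A.
Proof.
move=> mP mQ A mA.
apply: (measure_unique cylinders (fun=> setT)) => //.
- exact: measurable_cylinders.
- move=> _ _ [s _ [B ->]] [t _ [C ->]].
  suff -> : cylinder s B `&` cylinder t C = cylinder (s ++ t)
      (fun n => [set b | (n \in s -> B n b) /\ (n \in t -> C n b)]).
    exact: cylindersP.
  apply/seteqP; split => x /=.
    by move=> [xB xC] n _; split; [exact: xB|exact: xC].
  by move=> xBC; split => n ns; have [] := xBC n; rewrite ?mem_cat ns ?orbT//;
     [move=> + _; exact|move=> _; exact].
- move=> _; exists [::] => //; exists (fun=> setT).
  by apply/seteqP; split.
- by rewrite bigcup_const.
- by move=> _ [s us [B ->]]; rewrite [LHS]mP// [RHS]mQ.
- by move=> k; apply: (le_lt_trans (probability_le1 P measurableT)); rewrite ltry.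
Qed.

End product_measure.

Section bisection.
Context {R : realType}.
Variable m : nat -> probability bool R.

Let q j : R := fine (m j [set false]).

(* [bisect 0 0 1 i x] is the i-th digit of [x \in [0, 1)] when, at each stage,
   the current interval [[l, l + w)] is cut in proportion
   [m j {false} : m j {true}]. *)
Fixpoint bisect (j : nat) (l w : R) (i : nat) (x : R) : bool :=
  let c := l + q j * w in
  if i is i'.+1 then
    if c <= x then bisect j.+1 c ((1 - q j) * w) i' x
    else bisect j.+1 l (q j * w) i' x
  else c <= x.

Lemma measurable_bisect j l w i : measurable_fun setT (bisect j l w i).
Proof.
elim: i j l w => [|i ih] j l w /=; first exact: measurable_fun_ler.
by apply: measurable_fun_ifT => //; exact: measurable_fun_ler.
Qed.

Let q01 j : 0 <= q j <= 1.
Proof.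
rewrite /q -!lee_fin fineK ?fin_num_measure// measure_ge0/=.
exact: probability_le1.
Qed.

Let mE j (A : set bool) :
  m j A = ((if false \in A then q j else 0) +
           (if true \in A then 1 - q j else 0))%:E.
Proof.
have mf : m j [set false] = (q j)%:E by rewrite fineK ?fin_num_measure.
have mt : m j [set true] = (1 - q j)%:E.
  have -> : [set true] = ~` [set false] by apply/seteqP; split=> [_ -> //|[]//= /(_ erefl)].
  by rewrite probability_setC// mf.
have AE : A = (if false \in A then [set false] else set0) `|`
              (if true \in A then [set true] else set0).
  apply/seteqP; split => [[] Ab|b].
  - by right; rewrite mem_set.
  - by left; rewrite mem_set.
  - by case=> [|]; case: ifPn => //; rewrite inE => ? ->.
rewrite [in LHS]AE measureU//; last first.
  by do 2 case: ifP => _; apply/seteqP; split=> -[]//= [].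
by rewrite EFinD; congr (_ + _)%E; case: ifP => _; rewrite ?measure0 ?mf ?mt.
Qed.

Let box (A : nat -> set bool) N j l w : set R :=
  [set x | l <= x < l + w /\ forall i, (i < N)%N -> A (j + i)%N (bisect j l w i x)].

Let boxS A N j l w : 0 <= w ->
  box A N.+1 j l w =
  (if false \in A j then box A N j.+1 l (q j * w) else set0) `|`
  (if true \in A j then box A N j.+1 (l + q j * w) ((1 - q j) * w) else set0).
Proof.
move=> w0; have /andP[q0 q1] := q01 j.
have qw0 : 0 <= q j * w by rewrite mulr_ge0.
have qw1 : 0 <= (1 - q j) * w by rewrite mulr_ge0// subr_ge0.
apply/seteqP; split => x /=.
  move=> [xlw xA].
  have H0 := xA 0%N erefl; rewrite addn0 /= in H0.
  have HS i : (i < N)%N -> _ := fun iN => xA i.+1 iN.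
  case: (leP (l + q j * w) x) => cx; rewrite ?cx in H0.
    right; rewrite mem_set//; split; first lra.
    by move=> i /HS; rewrite /= cx addSnnS.
  rewrite leNgt cx /= in H0.
  left; rewrite mem_set//; split; first lra.
  by move=> i /HS; rewrite /= leNgt cx addSnnS.
case; case: ifPn => //; rewrite inE => Ab [xlw xA]; (split; first lra).
  have cx : (l + q j * w <= x) = false by apply/negbTE; rewrite -ltNge; lra.
  by case=> [_|i iN] /=; rewrite cx ?addn0// -addSnnS; exact: xA.
have cx : (l + q j * w <= x) = true by lra.
by case=> [_|i iN] /=; rewrite cx ?addn0// -addSnnS; exact: xA.
Qed.

Let box_measure A N j l w : 0 <= w ->
  measurable (box A N j l w) /\
  lebesgue_measure (box A N j l w) =
    (w%:E * \prod_(j <= i < j + N) m i (A i))%E.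
Proof.
elim: N j l w => [|N ih] j l w w0.
  have -> : box A 0 j l w = `[l, (l + w)[%classic.
    by apply/seteqP; split=> x /=; rewrite in_itv/= => // -[].
  split => //; rewrite addn0 big_geq// mule1 lebesgue_measure_itv/= lte_fin.
  by case: ltP => lw; rewrite -?EFinD//; congr (_%:E); lra.
have /andP[q0 q1] := q01 j.
have qw0 : 0 <= q j * w by rewrite mulr_ge0.
have qw1 : 0 <= (1 - q j) * w by rewrite mulr_ge0// subr_ge0.
have [m0 e0] := ih j.+1 l _ qw0.
have [m1 e1] := ih j.+1 (l + q j * w) _ qw1.
rewrite boxS//; split.
  by apply: measurableU; case: ifP.
rewrite measureU//; last 3 first.
- by case: ifP.
- by case: ifP.
- case: ifP => _; last by rewrite set0I.
  case: ifP => _; last by rewrite setI0.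
  by apply/seteqP; split=> x //= [[+ _] [+ _]]; lra.
rewrite big_ltn ?addnS ?ltnS ?leq_addr// -addSn.
set p := (\prod_(_ <= i < _) _)%E in e0 e1 *.
rewrite mE muleA -EFinM mulrDr EFinD.
have p0 : (0 <= p)%E by apply: prode_ge0 => i _; exact: measure_ge0.
rewrite ge0_muleDl; last 2 first.
- by rewrite lee_fin mulr_ge0//; case: ifP.
- by rewrite lee_fin mulr_ge0//; case: ifP => //; lra.
congr (_ + _)%E; case: ifP => _; rewrite ?mulr0 ?mul0e ?measure0//.
  by rewrite [LHS]e0 mulrC.
by rewrite [LHS]e1 mulrC.
Qed.

Lemma bisect_measure (A : nat -> set bool) N :
  lebesgue_measure ([set x | forall i, (i < N)%N -> A i (bisect 0 0 1 i x)]
                    `&` `[0, 1[%classic : set R) =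
  (\prod_(0 <= i < N) m i (A i))%E.
Proof.
have [_] := box_measure A N 0 0 ler01; rewrite mul1e add0n => <-.
congr (lebesgue_measure _); rewrite /box add0r.
apply/seteqP; split => x /=; rewrite in_itv/=.
  by move=> [].
by move=> [].
Qed.

End bisection.

Section existence.
Context {R : realType}.
Variable m : int -> probability bool R.

Let m' i : probability bool R := m (odflt 0 (@pickle_inv int i)).

Definition bisect_config (x : measurableTypeR R) : config := fun n => bisect m' 0 0 1 (pickle n) x.

Lemma measurable_bisect_config : measurable_fun setT bisect_config.
Proof.
apply: (measurability cylinders); first exact: measurable_cylinders.
move=> _ [_ [s _ [A ->]] <-]; rewrite setTI cylinderE preimage_bigcap.
apply: fin_bigcap_measurable; first exact: finite_seq.
move=> n _; rewrite -[X in measurable X]setTI -comp_preimage.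
by apply: measurable_bisect.
Qed.

HB.instance Definition _ :=
  isMeasurableFun.Build _ _ _ _ bisect_config measurable_bisect_config.

Definition uniform01 : set (measurableTypeR R) -> \bar R :=
  mrestr lebesgue_measure (measurable_itv `[0%R, 1%R[).

HB.instance Definition _ := Measure.on uniform01.

Lemma uniform01T : uniform01 setT = 1%E.
Proof.
by rewrite /uniform01 /mrestr setTI lebesgue_measure_itv/= lte_fin ltr01 sube0.
Qed.

HB.instance Definition _ := Measure_isProbability.Build _ _ _ uniform01 uniform01T.

Lemma product_measure_exists : exists P, is_product_measure m P.
Proof.
exists (distribution uniform01 bisect_config) => s A us.
pose A' i := if @pickle_inv int i is Some n then if n \in s then A n else setT else setT.
pose N := (\max_(n <- s) pickle n).+1.
have sN n : n \in s -> (pickle n < N)%N.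
  by move=> ns; rewrite ltnS; exact: leq_bigmax_seq.
transitivity (lebesgue_measure
    ([set x | forall i, (i < N)%N -> A' i (bisect m' 0 0 1 i x)]
     `&` `[0, 1[%classic : set R)).
  rewrite /distribution /pushforward /uniform01 /= /mrestr.
  congr (lebesgue_measure (_ `&` _)); apply/seteqP; split => x /= xA.
    move=> i iN; rewrite /A'; case E: (@pickle_inv int i) => [n|//].
    case: ifPn => // ns; have := xA _ ns; rewrite /bisect_config.
    by have := @pickle_invK int i; rewrite E /= => ->.
  move=> n ns; have := xA _ (sN _ ns).
  by rewrite /A' pickleK_inv ns.
rewrite bisect_measure.
transitivity (\prod_(i <- [seq pickle n | n <- s]) m' i (A' i))%E; last first.
  rewrite big_map; apply: eq_big_seq => n ns.
  by rewrite /m' /A' pickleK_inv ns.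
rewrite (bigID (fun i => i \in [seq pickle n | n <- s]))/=.
rewrite [X in (_ * X)%E]big1 ?mule1; last first.
  move=> i /negP si; rewrite /A'; have := @pickle_invK int i.
  case: (pickle_inv i) => [n /= ni|_]; last exact: probability_setT.
  case: ifPn => ns; last exact: probability_setT.
  by exfalso; apply: si; rewrite -ni map_f.
rewrite -big_filter; apply: perm_big; apply: uniq_perm.
- by rewrite filter_uniq// iota_uniq.
- by rewrite map_inj_uniq//; exact: (pcan_inj pickleK).
move=> i; rewrite mem_filter mem_index_iota /=.
by case: mapP => //= -[n ns ->]; rewrite sN.
Qed.

End existence.

Definition product_measure {R : realType} (m : int -> probability bool R) :
  probability config R := sval (cid (product_measure_exists m)).

Lemma product_measureP {R : realType} (m : int -> probability bool R) :
  is_product_measure m (product_measure m).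
Proof. exact: svalP (cid (product_measure_exists m)). Qed.

Section bernoulli_shift.
Context {R : realType}.
Implicit Types (c : R) (n : int).

Definition nu0 c n : R :=
  1 / 2 + c / Num.sqrt n%:~R *
    ((1 <= n) && (c / Num.sqrt n%:~R < 1 / 2))%:R.

(* [bernoulli_prob p] gives mass [p] to [true]; its junk value for [p] outside
   [0, 1] never occurs when [0 < c]. *)
Definition nu_marginal c n : probability bool R := bernoulli_prob (1 - nu0 c n).

Lemma nu_marginal0 c n : 0 < c -> nu_marginal c n [set false] = (nu0 c n)%:E.
Proof.
move=> c0.
have h : 0 <= c / Num.sqrt n%:~R by rewrite divr_ge0// ?sqrtr_ge0// ltW.
have : 1 / 2 <= nu0 c n <= 1.
  move: h; rewrite /nu0; move: (c / _) => t t0.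
  case: (boolP ((1 <= n) && _)) => [/andP[_ t1]|_] /=.
    by rewrite mulr1; lra.
  by rewrite mulr0; lra.
move=> /andP[n0 n1]; rewrite /= /bernoulli_prob ifT; last lra.
by rewrite fsbig_set1 /bernoulli_pmf; congr (_%:E); lra.
Qed.

Definition nu c : probability config R := product_measure (nu_marginal c).

End bernoulli_shift.

Section dynamics.
Context d (X : measurableType d) {R : realType}.
Implicit Types (mu : {measure set X -> \bar R}) (S : X -> X) (E W : set X).

(* [S^n E] for an invertible [S]. *)
Definition ziter_image S (n : int) E : set X :=
  match n with
  | Posz k => iter k S @` E
  | Negz k => iter k.+1 S @^-1` E
  end.

Definition conservative mu S := forall E, measurable E -> (0 < mu E)%E ->
  exists2 n : int, n != 0 & (0 < mu (E `&` ziter_image S (- n) E))%E.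

Definition dissipative mu S := exists W, [/\ measurable W,
  trivIset [set: int] (fun n => ziter_image S n W) &
  mu.-negligible (~` \bigcup_n ziter_image S n W)].

Definition ergodic mu S := forall E, measurable E -> S @^-1` E = E ->
  mu E = 0%E \/ mu (~` E) = 0%E.

End dynamics.

Section direct_power.
Context d (X : measurableType d) {R : realType}.

Definition tuple_cons n (z : X * n.-tuple X) : n.+1.-tuple X :=
  [tuple of z.1 :: z.2].

Lemma measurable_tuple_cons n : measurable_fun setT (@tuple_cons n).
Proof. exact: measurable_cons. Qed.

HB.instance Definition _ n :=
  isMeasurableFun.Build _ _ _ _ (@tuple_cons n) (@measurable_tuple_cons n).

(* The n-fold product measure [mu \x ... \x mu], carried over to tuples. *)
Fixpoint power_measure (mu : probability X R) n : probability (n.-tuple X) R :=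
  if n is n'.+1 then
    distribution (mu \x power_measure mu n')%E (@tuple_cons n')
  else \d_([tuple] : 0.-tuple X).

Lemma power_measure_box (mu : probability X R) n (A : 'I_n -> set X) :
  (forall i, measurable (A i)) ->
  power_measure mu n [set t | forall i, A i (tnth t i)] =
  (\prod_(i < n) mu (A i))%E.
Proof.
elim: n A => [|n ih] A mA.
  rewrite big_ord0 /= diracE mem_set// => -[].
  by case.
rewrite big_ord_recl -ih// /= /distribution /pushforward.
rewrite -product_measure1E//; last first.
  rewrite (_ : [set _ | _] =
      \bigcap_(i in [set: 'I_n]) ((tnth (T:=X))^~ i @^-1` A (lift ord0 i))).
    apply: fin_bigcap_measurable; first exact: finite_finset.
    move=> i _; rewrite -[X in measurable X]setTI.
    exact: measurable_tnth.
  by apply/seteqP; split => t /= tA i; [move=> _|]; exact: tA.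
congr (product_measure1 _ _ _); apply/seteqP; split => -[x t] /=.
  move=> xA; split=> [|i]; first exact: (xA ord0).
  by have := xA (lift ord0 i); rewrite tnthS.
move=> [x0 tA] i; case: (unliftP ord0 i) => [j|] ->; last exact: x0.
by rewrite tnthS; exact: tA.
Qed.

(* [map_tuple S] is the direct product [S x ... x S]. *)
Definition ergodic_index (mu : probability X R) (S : X -> X) (k : nat) :=
  [/\ (0 < k)%N, ergodic mu S,
      ergodic (power_measure mu k) (map_tuple S) &
      ~ ergodic (power_measure mu k.+1) (map_tuple S)].

End direct_power.

(* [(nu, T)] is a factor of [(rho, S)]; the equivalence of measures is
   mutual absolute continuity. *)
Definition is_factor d d' (X : measurableType d) (Y : measurableType d')
    (R : realType) (nu : probability Y R) (T : Y -> Y)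
    (rho : probability X R) (S : X -> X) :=
  exists phi : X -> Y, [/\ measurable_fun [set: X] phi,
    phi \o S = T \o phi,
    pushforward rho phi `<< nu & nu `<< pushforward rho phi].

(* Main.v *)
Require Import Defs.
From mathcomp Require Import all_boot all_order all_algebra.
From mathcomp Require Import all_classical all_reals all_analysis.
From mathcomp Require Import measurable_realfun.

Import Order.TTheory GRing.Theory Num.Theory.
Local Open Scope classical_set_scope.
Local Open Scope ring_scope.

(** A factor inherits ergodicity of direct powers, and the ergodic index
    measures how many powers stay ergodic, so passing to a factor cannot lower
    the index.  In detail, let [phi] be a factor map from [nu c] to [nu c'].
    Since [k' < k], the [k'.+1]-st power of [nu c] is ergodic: it is a factor of
    the [k]-th power, which is ergodic, through a coordinate projection
    ([ergodic_power_measure_le]).  The map [phi x ... x phi] intertwines the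
    product shifts, and [nu c'] being absolutely continuous with respect to the
    image of [nu c], the [k'.+1]-st power of [nu c'] is absolutely continuous
    with respect to the image of the corresponding power of [nu c]
    ([power_measure_dominates], an application of Tonelli's theorem).  Thus the
    [k'.+1]-st power of [nu c'] is ergodic as well ([ergodic_factor]), which
    contradicts [nu c'] having ergodic index [k']. *)

Lemma measurable_preimage {d d'} {X : measurableType d} {Y : measurableType d'}
    {f : X -> Y} {B : set Y} :
  measurable_fun [set: X] f -> measurable B -> measurable (f @^-1` B).
Proof. by move=> mf mB; rewrite -[X in measurable X]setTI; exact: mf. Qed.

Lemma dominates_pushforwardP {d d'} {X : measurableType d}
    {Y : measurableType d'} {R : realType} {rho : probability X R}
    {f : X -> Y} (nu : set Y -> \bar R) : measurable_fun [set: X] f ->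
  nu `<< pushforward rho f <->
  forall A, measurable A -> rho (f @^-1` A) = 0%E -> nu A = 0%E.
Proof.
move=> mf; split=> [dom A mA fA0|dom N fN0 A mA AN]; last first.
  by apply: dom => //; exact: fN0.
apply: (dom A) => // B mB BA.
apply: (subset_measure0 _ _ _ fA0); [exact: measurable_preimage..|].
by move=> x; exact: BA.
Qed.

Lemma measurable_xsection_neq0 {d d'} {X : measurableType d}
    {Y : measurableType d'} {R : realType} (m : probability Y R)
    (A : set (X * Y)) : measurable A ->
  measurable [set x | m (xsection A x) != 0%E].
Proof.
move=> mA; rewrite -[X in measurable X]setTI; apply: emeasurable_neq => //.
exact: measurable_fun_xsection.
Qed.

(** Tonelli: both sides say that the nonnegative function
    [x |-> m2 (xsection A x)] has integral zero. *)
Lemma product_measure_eq0 {d d'} {X : measurableType d} {Y : measurableType d'}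
    {R : realType} (m1 : probability X R) (m2 : probability Y R)
    (A : set (X * Y)) : measurable A ->
  (m1 \x m2)%E A = 0%E <-> m1 [set x | m2 (xsection A x) != 0%E] = 0%E.
Proof.
move=> mA; have mx := measurable_fun_xsection m2 mA.
have mN := measurable_xsection_neq0 m2 A mA.
have -> : (m1 \x m2)%E A = (\int[m1]_x `|(m2 \o xsection A) x|)%E.
  by apply: eq_integral => x _; rewrite gee0_abs.
have NE : [set x | m2 (xsection A x) != 0%E] =
    ~` [set x | setT x -> (m2 \o xsection A) x = cst 0%E x].
  apply/seteqP; split => x /=; first by move=> /eqP + /(_ I).
  by move=> h; apply/eqP => h0; apply: h.
apply: (iff_trans (ae_eq_integral_abs _ measurableT mx)).
split=> [h|h]; first by apply: measure_negligible => //; rewrite NE.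
by exists [set x | m2 (xsection A x) != 0%E]; split => //; rewrite NE.
Qed.

(** If the preimage of [A] is null, almost all its sections are null.  They are
    preimages of sections of [A], so absolute continuity in the second factor
    makes the section of [A] at [f1 x] null for almost every [x]; absolute
    continuity in the first factor turns this into almost every section of
    [A]. *)
Lemma product_measure_dominates {d1 d1' d2 d2'}
    {X1 : measurableType d1} {Y1 : measurableType d1'}
    {X2 : measurableType d2} {Y2 : measurableType d2'} {R : realType}
    {rho1 : probability X1 R} {rho2 : probability X2 R}
    {nu1 : probability Y1 R} {nu2 : probability Y2 R}
    {f1 : X1 -> Y1} {f2 : X2 -> Y2} :
  measurable_fun [set: X1] f1 -> measurable_fun [set: X2] f2 ->
  nu1 `<< pushforward rho1 f1 -> nu2 `<< pushforward rho2 f2 ->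
  (nu1 \x nu2)%E `<<
    pushforward (rho1 \x rho2)%E (fun z => (f1 z.1, f2 z.2)).
Proof.
move=> mf1 mf2 /(dominates_pushforwardP _ mf1) dom1.
move=> /(dominates_pushforwardP _ mf2) dom2.
have mf : measurable_fun [set: X1 * X2] (fun z => (f1 z.1, f2 z.2)).
  apply: measurable_fun_pair.
    exact: measurableT_comp mf1 measurable_fst.
  exact: measurableT_comp mf2 measurable_snd.
apply/(dominates_pushforwardP _ mf) => A mA.
have mfA := measurable_preimage mf mA.
move=> /(product_measure_eq0 _ _ _ mfA) rho0.
apply/product_measure_eq0 => //.
have mN := measurable_xsection_neq0 nu2 A mA.
apply: dom1 => //; apply: (subset_measure0 _ _ _ rho0).
- exact: measurable_preimage.
- exact: measurable_xsection_neq0.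
(* The section of the preimage of [A] at [x] is the preimage under [f2] of the
   section of [A] at [f1 x]. *)
move=> x /=; apply: contra => /eqP rhox.
apply/eqP; apply: dom2; first exact: measurable_xsection.
by rewrite -[RHS]rhox !xsectionE.
Qed.

Lemma measurable_map_tuple {d d'} {X : measurableType d}
    {Y : measurableType d'} {f : X -> Y} n : measurable_fun [set: X] f ->
  measurable_fun [set: n.-tuple X] (map_tuple f (n := n)).
Proof.
move=> mf; apply/measurable_fun_tnthP => i.
rewrite (_ : _ \o _ = f \o (@tnth n X)^~ i); last first.
  by apply/funext => t /=; rewrite tnth_map.
exact: measurableT_comp mf (measurable_tnth i).
Qed.

Lemma power_measure_dominates {d d'} {X : measurableType d}
    {Y : measurableType d'} {R : realType} {rho : probability X R}
    {nu : probability Y R} {f : X -> Y} n : measurable_fun [set: X] f ->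
  nu `<< pushforward rho f ->
  power_measure nu n `<< pushforward (power_measure rho n) (map_tuple f).
Proof.
move=> mf dom; elim: n => [|n ih].
  apply/dominates_pushforwardP; first exact: measurable_map_tuple.
  move=> A mA /=; rewrite !diracE.
  have -> // : ([tuple] \in map_tuple f @^-1` A) = ([tuple] \in A).
  by apply/idP/idP; rewrite !inE /= (tuple0 (map_tuple f _)).
apply/dominates_pushforwardP; first exact: measurable_map_tuple.
have := product_measure_dominates mf (measurable_map_tuple n mf) dom ih.
move=> /dominates_pushforwardP dom2.
move=> A mA rho0; apply: dom2.
- apply: measurable_fun_pair.
    exact: measurableT_comp mf measurable_fst.
  exact: measurableT_comp (measurable_map_tuple n mf) measurable_snd.
- exact: measurable_preimage (@measurable_tuple_cons _ _ _) mA.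
- rewrite -[RHS]rho0 /= /distribution /pushforward.
  congr ((_ \x _)%E _); apply/seteqP; split => -[x t] /=;
    by rewrite (_ : tuple_cons _ = map_tuple f (tuple_cons (x, t)))//;
       apply/val_inj.
Qed.

(** An invariant set [E] satisfies [T @^-1` E = E], so its pullback along [f] is
    invariant on the nose; ergodicity upstairs makes the pullback null or conull,
    and absolute continuity passes this down to [E]. *)
Lemma ergodic_factor {d d'} {X : measurableType d} {Y : measurableType d'}
    {R : realType} {rho : probability X R} {nu : probability Y R}
    {S : X -> X} {T : Y -> Y} {f : X -> Y} :
  measurable_fun [set: X] f -> (forall x, f (S x) = T (f x)) ->
  nu `<< pushforward rho f -> ergodic rho S -> ergodic nu T.
Proof.
move=> mf fST /(dominates_pushforwardP _ mf) dom ergS E mE TE.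
have [] := ergS (f @^-1` E).
- exact: measurable_preimage.
- by rewrite -[in RHS]TE; apply/seteqP; split => x /=; rewrite fST.
- by left; exact: dom.
- by right; apply: dom => //; exact: measurableC.
Qed.

(** The total mass of the forgotten coordinate is one, so dropping it makes the
    [n]-th power a factor of the next one. *)
Lemma power_measure_behead {d} {X : measurableType d} {R : realType}
    (mu : probability X R) n (A : set (n.-tuple X)) : measurable A ->
  power_measure mu n.+1
    ((fun t : n.+1.-tuple X => [tuple of behead t]) @^-1` A) =
  power_measure mu n A.
Proof.
move=> mA; rewrite /= /distribution /pushforward.
have beheadK x (t : n.-tuple X) : [tuple of behead (tuple_cons (x, t))] = t.
  exact/val_inj.
rewrite (_ : _ @^-1` _ = [set: X] `*` A).
  have := product_measure1E mu (power_measure mu n) (@measurableT _ X) mA.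
  by rewrite [X in (X * _)%E](probability_setT mu) mul1e.
by apply/seteqP; split => -[x t]; rewrite /preimage/= beheadK // => -[].
Qed.

(** Dropping a coordinate commutes with the product map, hence each power is a
    factor of the following one, and ergodicity descends step by step. *)
Lemma ergodic_power_measure_le {d} {X : measurableType d} {R : realType}
    {mu : probability X R} {S : X -> X} m n : (n <= m)%N ->
  ergodic (power_measure mu m) (map_tuple S) ->
  ergodic (power_measure mu n) (map_tuple S).
Proof.
move=> /subnKC <-; elim: (m - n)%N => [|j ih]; first by rewrite addn0.
rewrite addnS => erg; apply: ih; move: erg.
apply: (ergodic_factor
  (f := fun t : (n + j).+1.-tuple X => [tuple of behead t])).
- exact: measurable_behead.
- by move=> t; apply/val_inj; rewrite /= behead_map.
- apply/dominates_pushforwardP; first exact: measurable_behead.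
  by move=> A mA; rewrite power_measure_behead.
Qed.

Theorem corollary4 (R : realType) (D : R)
  (D_gt : 1 / 6 < D)
  (D_conservative : forall c : R, 0 < c < D -> conservative (nu c) left_shift)
  (D_dissipative : forall c : R, D < c -> dissipative (nu c) left_shift)
  (D_index : forall (k : nat) (c : R), (1 <= k)%N ->
    D / Num.sqrt k.+1%:R < c < D / Num.sqrt k%:R ->
    ergodic_index (nu c) left_shift k)
  (k' k : nat) (k'_ge1 : (1 <= k')%N) (k'_lt : (k' < k)%N)
  (c c' : R)
  (hc : D / Num.sqrt k.+1%:R < c < D / Num.sqrt k%:R)
  (hc' : D / Num.sqrt k'.+1%:R < c' < D / Num.sqrt k'%:R) :
  ~ is_factor (nu c') left_shift (nu c) left_shift.
Proof.
move=> [phi [mphi phiS _ dom]].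
have [_ _ erg_k _] := D_index k c (ltn_trans k'_ge1 k'_lt) hc.
have [_ _ _] := D_index k' c' k'_ge1 hc'; apply.
have := ergodic_power_measure_le _ _ k'_lt erg_k.
apply: (ergodic_factor (measurable_map_tuple k'.+1 mphi)).
- move=> t; apply/eq_from_tnth => i; rewrite !tnth_map.
  exact: (congr1 (fun h => h (tnth t i)) phiS).
- exact: power_measure_dominates.
Qed.
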